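(* Let $n\ge 3$ and let $K$ be a convex body in $\mathbb{R}^n$ such that all orthogonal projections of $K$ are 1-symmetric, i.e. for every linear subspace $H$ of $\mathbb{R}^n$ with $1\le \dim H\le n-1$ the orthogonal projection $K|H$ of $K$ onto $H$ is 1-symmetric as a subset of $H$. Then $K$ is a Euclidean ball.
   Context: A convex body in $\mathbb{R}^n$ is a compact convex set with non-empty interior. For a finite-dimensional Euclidean space $H$ and $A\subseteq H$, the symmetry group of $A$ is the group of all isometries $T$ of $H$ (not necessarily linear) with $TA=A$. The set $A$ is called 1-symmetric if its symmetry group contains the symmetry group of some cube in $H$ (of dimension $\dim H$, with arbitrary center and orientation). *)

(* Defs.v *)
From mathcomp Require Import all_boot all_order all_algebra.
From mathcomp Require Import all_classical all_reals all_analysis.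

Set Implicit Arguments.
Unset Strict Implicit.
Unset Printing Implicit Defensive.

Import Order.TTheory GRing.Theory Num.Theory.
Import numFieldNormedType.Exports.

Local Open Scope classical_set_scope.
Local Open Scope ring_scope.

Section EuclideanSpace.
Context {R : realType} {n : nat}.
Implicit Types (u v x p c : 'rV[R]_n) (A K Q : set 'rV[R]_n).
Implicit Types (H : {vspace 'rV[R]_n}) (T : 'rV[R]_n -> 'rV[R]_n).

Definition dot u v : R := \sum_(i < n) u 0 i * v 0 i.

(* The library norm `|u| on 'rV[R]_n is the sup norm; it induces the same
   topology as enorm, but isometries and balls must be taken for enorm. *)
Definition enorm u : R := Num.sqrt (dot u u).

Definition convex_body K : Prop :=
  [/\ compact K, convex_set (K : set (convex_lmodType 'rV[R]_n))
    & interior K !=set0].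

(* A map of H is represented by a total map T, of which only the restriction
   to H is constrained; the values of T outside H are irrelevant. *)
Definition isometry_of H T : Prop :=
  T @` [set` H] = [set` H] /\
  {in H &, forall x y, enorm (T x - T y) = enorm (x - y)}.

Definition symmetry_group H A : set ('rV[R]_n -> 'rV[R]_n) :=
  [set T | isometry_of H T /\ T @` A = A].

Definition orthonormal_basis H (e : (\dim H).-tuple 'rV[R]_n) : Prop :=
  basis_of H e /\ forall i j, dot (tnth e i) (tnth e j) = (i == j)%:R.

Definition is_cube H Q : Prop :=
  exists c (r : R) (e : (\dim H).-tuple 'rV[R]_n),
    [/\ c \in H, 0 < r, orthonormal_basis e
      & Q = [set x | exists2 t : 'I_(\dim H) -> R,
               (forall i, `|t i| <= r)
             & x = c + \sum_(i < \dim H) t i *: tnth e i]].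

Definition one_symmetric H A : Prop :=
  exists2 Q, is_cube H Q & symmetry_group H Q `<=` symmetry_group H A.

Definition is_orthoproj H x p : Prop :=
  p \in H /\ {in H, forall y, dot (x - p) y = 0}.

Definition projection H K : set 'rV[R]_n :=
  [set p | exists2 x, K x & is_orthoproj H x p].

Definition euclidean_ball A : Prop :=
  exists c, exists2 r : R, 0 < r & A = [set x | enorm (x - c) <= r].

End EuclideanSpace.

(* Main.v *)
(** Let [h] be the support function of [K].  If [u, v] are orthonormal and [H]
    is their span, a quarter turn of the square attached to [K|H] maps [u] to
    [v] or [-v], so [h u + h (- u) = h v + h (- v)]; as [n >= 3], any two unit
    vectors have a common orthogonal unit vector, so [K] has constant width.
    The central symmetry of [K|H] shows that [h u - h (- u)] is linear on every
    plane, hence linear.  Therefore [h u = <c, u> + r] on the unit sphere, i.e.,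
    [K] has the support function of a ball. *)
Require Import Defs.
From mathcomp Require Import all_boot all_order all_algebra.
From mathcomp Require Import all_classical all_reals all_analysis.
From mathcomp Require Import ring lra.

Set Implicit Arguments.
Unset Strict Implicit.

Import Order.TTheory GRing.Theory Num.Theory.
Import numFieldNormedType.Exports.
Local Open Scope classical_set_scope.
Local Open Scope ring_scope.

(** * Euclidean inner product and norm *)

Section Dot.
Context {R : realType} {n : nat}.
Implicit Types (u v x y : 'rV[R]_n) (a : R).

Lemma dotC u v : dot u v = dot v u.
Proof. by apply: eq_bigr => i _; rewrite mulrC. Qed.

Lemma dotDl u v x : dot (u + v) x = dot u x + dot v x.
Proof. by rewrite -big_split; apply: eq_bigr => i _; rewrite mxE mulrDl. Qed.

Lemma dotZl a u x : dot (a *: u) x = a * dot u x.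
Proof. by rewrite mulr_sumr; apply: eq_bigr => i _; rewrite mxE mulrA. Qed.

Lemma dotNl u x : dot (- u) x = - dot u x.
Proof. by rewrite -scaleN1r dotZl mulN1r. Qed.

Lemma dotBl u v x : dot (u - v) x = dot u x - dot v x.
Proof. by rewrite dotDl dotNl. Qed.

Lemma dotDr u v x : dot x (u + v) = dot x u + dot x v.
Proof. by rewrite dotC dotDl !(dotC x). Qed.

Lemma dotZr a u x : dot x (a *: u) = a * dot x u.
Proof. by rewrite dotC dotZl (dotC x). Qed.

Lemma dotNr u x : dot x (- u) = - dot x u.
Proof. by rewrite dotC dotNl (dotC x). Qed.

Lemma dotBr u v x : dot x (u - v) = dot x u - dot x v.
Proof. by rewrite dotDr dotNr. Qed.

Lemma dot0l x : dot 0 x = 0.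
Proof. by rewrite -(scale0r x) dotZl mul0r. Qed.

Lemma dot_suml I (r : seq I) (F : I -> 'rV[R]_n) x :
  dot (\sum_(i <- r) F i) x = \sum_(i <- r) dot (F i) x.
Proof. exact: (big_morph (dot^~ x) (fun u v => dotDl u v x) (dot0l x)). Qed.

Lemma dot_ge0 u : 0 <= dot u u.
Proof. by apply: sumr_ge0 => i _; rewrite -expr2 sqr_ge0. Qed.

Lemma dot_eq0 u : (dot u u == 0) = (u == 0).
Proof.
apply/eqP/eqP => [u0|->]; last exact: dot0l.
apply/rowP => i; rewrite mxE; apply/eqP; rewrite -sqrf_eq0 expr2.
by apply/eqP/(psumr_eq0P _ u0) => // j _; rewrite -expr2 sqr_ge0.
Qed.

Lemma enorm_ge0 u : 0 <= enorm u.
Proof. exact: sqrtr_ge0. Qed.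

Lemma sqr_enorm u : enorm u ^+ 2 = dot u u.
Proof. by rewrite sqr_sqrtr ?dot_ge0. Qed.

Lemma enorm_gt0 u : (0 < enorm u) = (u != 0).
Proof. by rewrite sqrtr_gt0 lt0r dot_ge0 andbT dot_eq0. Qed.

Lemma unit_scale u : u != 0 -> exists2 v, dot v v = 1 & u = enorm u *: v.
Proof.
rewrite -enorm_gt0 => u0; exists ((enorm u)^-1 *: u).
  by rewrite dotZl dotZr -sqr_enorm; field; rewrite gt_eqF.
by rewrite scalerA divff ?gt_eqF ?scale1r.
Qed.

(** Cauchy-Schwarz against a unit vector: the residual [u - dot u v *: v] has nonnegative square
    norm. *)
Lemma dot_le_enorm u v : dot v v = 1 -> dot u v <= enorm u.
Proof.
move=> v1; have [/le_trans->//|uv0] := leP (dot u v) 0; first exact: enorm_ge0.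
rewrite -(@ler_pXn2r _ 2) ?nnegrE ?enorm_ge0 ?(ltW uv0)// sqr_enorm.
have := dot_ge0 (u - dot u v *: v).
rewrite dotBl !dotBr !dotZl !dotZr (dotC v u) v1; lra.
Qed.

Lemma dot_continuous u : continuous (dot^~ u).
Proof.
apply: (@continuous_big _ _ _ _ _ _ 'rV[R]_n) => [|i _ x].
  exact: add_continuous.
by apply: (@continuousM R 'rV[R]_n);
  [exact: coord_continuous | exact: cst_continuous].
Qed.

Lemma sqr_dist_continuous u : continuous (fun x => dot (x - u) (x - u)).
Proof.
have -> : (fun x => dot (x - u) (x - u)) =
    (fun x => \sum_(i < n) (x 0 i - u 0 i) * (x 0 i - u 0 i)).
  by apply/funext => y; apply: eq_bigr => i _; rewrite !mxE.
apply: (@continuous_big _ _ _ _ _ _ 'rV[R]_n) => [|i _ x].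
  exact: add_continuous.
by apply: (@continuousM R 'rV[R]_n); apply: (@continuousB R R 'rV[R]_n);
  first [exact: coord_continuous | exact: cst_continuous].
Qed.

(** The [n] by 2 matrix with columns [u] and [v] has rank at most [2 < n], so its left kernel
    contains a nonzero row, which is then normalized. *)
Lemma orthogonal_unit u v : (2 < n)%N ->
  exists w, [/\ dot w w = 1, dot w u = 0 & dot w v = 0].
Proof.
move=> n2; pose A := row_mx u^T v^T.
have : kermx A != 0.
  rewrite -mxrank_eq0 mxrank_ker subn_eq0 -ltnNge.
  exact: leq_ltn_trans (rank_leq_col A) n2.
case/rowV0Pn => w /sub_kermxP wA w0.
have dotE x : dot w x = (w *m x^T) 0 0.
  by rewrite mxE; apply: eq_bigr => i _; rewrite mxE.
have : row_mx (w *m u^T) (w *m v^T) = 0 by rewrite -mul_mx_row.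
rewrite -row_mx0 => /eq_row_mx[wu wv].
have [z z1 wz] := unit_scale w0.
have norm_neq0 : enorm w != 0 by rewrite gt_eqF ?enorm_gt0.
exists z; split => //; apply: (mulfI norm_neq0);
  by rewrite mulr0 -dotZl -wz dotE ?wu ?wv mxE.
Qed.

End Dot.

(** * Support functions, separation, and symmetries of a projection *)

Section Support.
Context {R : realType} {n : nat}.
Implicit Types (u v x y c : 'rV[R]_n) (K : set 'rV[R]_n).

Definition supp K u : R := sup [set dot x u | x in K].

Lemma supp_eq K u x :
  K x -> (forall y, K y -> dot y u <= dot x u) -> supp K u = dot x u.
Proof.
move=> Kx xmax; apply/eqP; rewrite eq_le; apply/andP; split.
  by apply: ge_sup; [exists (dot x u), x | move=> _ [y Ky <-]; exact: xmax].
apply: ub_le_sup; last by exists x.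
by exists (dot x u) => _ [y Ky <-]; exact: xmax.
Qed.

Lemma supp_attained K u : compact K -> K !=set0 ->
  exists x, [/\ K x, supp K u = dot x u & forall y, K y -> dot y u <= dot x u].
Proof.
move=> cK K0; have [x /set_mem Kx xmax] : exists2 x, x \in K &
    forall y, y \in K -> dot y u <= dot x u.
  by apply: EVT_max_rV => //; apply/continuous_subspaceT/dot_continuous.
have {}xmax y : K y -> dot y u <= dot x u by move=> Ky; exact/xmax/mem_set.
by exists x; split=> //; exact: supp_eq.
Qed.

Lemma le_supp K u x : compact K -> K x -> dot x u <= supp K u.
Proof.
move=> cK Kx; have [y [_ -> ymax]] := supp_attained u cK (ex_intro _ x Kx).
exact: ymax.
Qed.

(** Take the point [p] of [K] nearest to [y] and normalize [y - p]. The angle at [p] between [y] and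
    any point of [K] is not acute, so [p] attains the support function in this direction. *)
Lemma supp_separation K y : compact K -> K !=set0 ->
  convex_set (K : set (convex_lmodType 'rV[R]_n)) -> ~ K y ->
  exists2 u, dot u u = 1 & supp K u < dot y u.
Proof.
move=> cK K0 convK nKy.
have [p /set_mem Kp pmin] : exists2 p, p \in K &
    forall x, x \in K -> dot (p - y) (p - y) <= dot (x - y) (x - y).
  by apply: EVT_min_rV => //; apply/continuous_subspaceT/sqr_dist_continuous.
have yp0 : y - p != 0.
  by rewrite subr_eq0; apply/eqP => yp; apply: nKy; rewrite yp.
have obtuse x : K x -> dot (x - p) (y - p) <= 0.
  move=> Kx; rewrite leNgt; apply/negP => a_gt0.
  set a := dot (x - p) (y - p) in a_gt0; set b := dot (x - p) (x - p).
  have b_ge0 : 0 <= b by exact: dot_ge0.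
  have ab_gt0 : 0 < a + b by rewrite ltr_pwDl.
  (* Move from [p] towards [x] by the parameter [t = a / (a + b)]. The squared distance to [y]
     changes by [t * (t * b - 2 * a)], which is negative since [t * b = a - t * a], against the
     choice of [p]. The denominator [a + b] keeps [t] at most 1. *)
  have t0 : 0 <= a / (a + b) by rewrite divr_ge0 ?ltW.
  have t1 : a / (a + b) <= 1 by rewrite ler_pdivrMr// mul1r lerDl.
  have := pmin _ (convK x p (Itv01 t0 t1) (mem_set Kx) (mem_set Kp)).
  have -> : conv (Itv01 t0 t1) (x : convex_lmodType 'rV[R]_n) p - y =
      (a / (a + b)) *: (x - p) - (y - p).
    rewrite /conv /=; apply/rowP => i; rewrite !mxE /unstable.onem; ring.
  have <- : - (y - p) = p - y by rewrite opprB.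
  have dotE t d e : dot (t *: d - e) (t *: d - e) =
      t * (t * dot d d) - t * (2 * dot d e) + dot e e.
    by rewrite !dotBl !dotBr !dotZl !dotZr (dotC e); ring.
  rewrite dotE dotNl dotNr opprK -/a -/b.
  set t := a / (a + b) => /= le_t.
  have tE : t * (a + b) = a by rewrite divfK ?gt_eqF.
  have t_gt0 : 0 < t by rewrite divr_gt0.
  have : t * (2 * a) <= t * (t * b) by lra.
  by rewrite ler_pM2l //; have := mulr_gt0 t_gt0 a_gt0; lra.
have [u u1 ypu] := unit_scale yp0; exists u => //.
have yp_gt0 : 0 < enorm (y - p) by rewrite enorm_gt0.
rewrite (@supp_eq K u p) //.
  by rewrite -subr_gt0 -dotBl ypu dotZl u1 mulr1.
move=> x Kx; rewrite -subr_le0 -dotBl -(pmulr_rle0 _ yp_gt0) -dotZr -ypu.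
exact: obtuse.
Qed.

(** Inner products with vectors of [H] do not distinguish a point from its projection. As [T] maps
    the projection of [K] onto itself and turns one functional into the other up to the shift [k],
    the two maxima differ by [k]. *)
Lemma supp_symmetry K (H : {vspace 'rV[R]_n}) T u v k :
  compact K -> K !=set0 -> (forall x, exists p, is_orthoproj H x p) ->
  symmetry_group H (projection H K) T -> u \in H -> v \in H ->
  (forall x, x \in H -> dot (T x) v = dot x u + k) ->
  supp K v = supp K u + k.
Proof.
move=> cK K0 projH [_ TP] uH vH Tuv.
have dot_proj x p w : is_orthoproj H x p -> w \in H -> dot p w = dot x w.
  by move=> [_ orth] /orth /eqP; rewrite dotBl subr_eq0 => /eqP.
have [x [Kx -> xmax]] := supp_attained u cK K0.
have [p xp] := projH x.
have : projection H K (T p) by rewrite -TP; exists p => //; exists x.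
move=> [y Ky yTp].
have yx : dot y v = dot x u + k.
  by rewrite -(dot_proj _ _ _ yTp vH) Tuv ?xp.1// (dot_proj _ _ _ xp uH).
(* Maximality of [y]: the projection of [z] is the [T]-image of the projection of some [w] in [K],
   and [w] does not exceed [x] in direction [u]. *)
rewrite -yx; apply: supp_eq => // z Kz; rewrite yx.
have [q zq] := projH z.
have : projection H K q by exists z.
rewrite -TP => -[q' [w Kw wq'] Tq'].
rewrite -(dot_proj _ _ _ zq vH) -Tq' Tuv ?wq'.1// lerD2r.
by rewrite (dot_proj _ _ _ wq' uH) xmax.
Qed.

End Support.

(** * Cubes in a subspace and two of their symmetries *)

Section Cube.
Context {R : realType} {n : nat}.
Implicit Types (u v x y c : 'rV[R]_n) (K A : set 'rV[R]_n).
Implicit Types (H : {vspace 'rV[R]_n}).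

Lemma orthonormal_expand H (e : (\dim H).-tuple 'rV[R]_n) x :
  orthonormal_basis e -> x \in H -> x = \sum_i dot x (tnth e i) *: tnth e i.
Proof.
move=> [eH eo] xH; rewrite {1}(coord_basis eH xH); apply: eq_bigr => i _.
rewrite (tnth_nth 0); congr (_ *: _).
rewrite [in RHS](coord_basis eH xH) dot_suml (bigD1 i)//= big1 ?addr0.
  by rewrite dotZl -!tnth_nth eo eqxx mulr1.
by move=> j ji; rewrite dotZl -!tnth_nth eo (negPf ji) mulr0.
Qed.

(** Coordinates in an orthonormal basis are inner products. In this form, invariance of the cube
    under a map is a check on [x - c]. *)
Lemma cubeE H (e : (\dim H).-tuple 'rV[R]_n) c r : orthonormal_basis e ->
  c \in H ->
  [set x | exists2 t : 'I_(\dim H) -> R, (forall i, `|t i| <= r)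
             & x = c + \sum_(i < \dim H) t i *: tnth e i] =
  [set x | x \in H /\ forall i, `|dot (x - c) (tnth e i)| <= r].
Proof.
move=> eb cH; have [eH eo] := eb; apply/seteqP; split => x /=.
  move=> [t tr ->]; split.
    apply: memvD => //; apply: memv_suml => i _; apply: memvZ.
    exact/(basis_mem eH)/mem_tnth.
  move=> i; rewrite [c + _]addrC addrK dot_suml (bigD1 i)//= big1 ?addr0.
    by rewrite dotZl eo eqxx mulr1.
  by move=> j ji; rewrite dotZl eo (negPf ji) mulr0.
move=> [xH xr]; exists (fun i => dot (x - c) (tnth e i)) => //.
by rewrite -orthonormal_expand ?memvB// addrC subrK.
Qed.

Lemma orthoproj_exists H (e : (\dim H).-tuple 'rV[R]_n) x :
  orthonormal_basis e -> exists p, is_orthoproj H x p.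
Proof.
move=> eb; have [eH eo] := eb.
exists (\sum_i dot x (tnth e i) *: tnth e i); split.
  apply: memv_suml => i _; apply: memvZ; exact/(basis_mem eH)/mem_tnth.
move=> y yH; rewrite {1}(orthonormal_expand eb yH) dotC dot_suml big1// => i _.
rewrite dotZl (dotC (tnth e i)) dotBl dot_suml (bigD1 i)//= big1 ?addr0.
  by rewrite dotZl eo eqxx mulr1 subrr mulr0.
by move=> j ji; rewrite dotZl eo (negPf ji) mulr0.
Qed.

Lemma image_eq_of_section A (T T' : 'rV[R]_n -> 'rV[R]_n) :
  (forall x, A x -> A (T x)) -> (forall x, A x -> A (T' x)) ->
  (forall x, A x -> T (T' x) = x) -> T @` A = A.
Proof.
move=> TA T'A TT'; apply/seteqP; split => [_ [x Ax <-]|x Ax]; first exact: TA.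
by exists (T' x); [exact: T'A | exact: TT'].
Qed.

(** The point reflection in the centre [c] of the cube preserves the cube, hence the projection, and
    exchanges the directions [u] and [- u]. *)
Lemma supp_opp_one_symmetric K H : compact K -> K !=set0 ->
  one_symmetric H (projection H K) ->
  exists c, forall u, u \in H -> supp K (- u) = supp K u - 2 * dot c u.
Proof.
move=> cK K0 [Q [c [r [e [cH r0 eb ->]]]] QK].
exists c => u uH; pose T x := c + c - x.
have TT x : T (T x) = x by rewrite /T subKr.
have Tc x : T x - c = - (x - c) by rewrite /T addrAC addrK opprB.
have TH x : x \in H -> T x \in H by move=> xH; rewrite memvB ?memvD.
apply: (@supp_symmetry _ _ _ H T) => //; [|apply: QK; split|..].
- by move=> x; exact: orthoproj_exists eb.
- split; first by apply: (image_eq_of_section (T' := T)).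
  move=> x y _ _; have -> : T x - T y = - (x - y).
    by apply/rowP => i; rewrite !mxE; ring.
  by rewrite /enorm dotNl dotNr opprK.
- rewrite cubeE//; apply: (image_eq_of_section (T' := T)) => //;
  by move=> x /= [xH xr]; split=> [|i]; rewrite ?TH ?Tc ?dotNl ?normrN.
- by rewrite memvN.
- move=> x xH; rewrite /T dotNr dotBl dotDl; ring.
Qed.

(** The quarter turn about the centre of the square preserves the projection, and in the plane it
    takes [u] to [v] or [- v]. *)
Lemma width_one_symmetric K H u v : compact K -> K !=set0 -> \dim H = 2%N ->
  one_symmetric H (projection H K) -> u \in H -> v \in H ->
  dot u u = 1 -> dot v v = 1 -> dot u v = 0 ->
  supp K u + supp K (- u) = supp K v + supp K (- v).
Proof.
move=> cK K0 dimH [Q [c [r [e [cH r0 eb ->]]]] QK] uH vH u1 v1 uv.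
have lt0 : (0 < \dim H)%N by rewrite dimH.
have lt1 : (1 < \dim H)%N by rewrite dimH.
pose i1 := Ordinal lt0; pose i2 := Ordinal lt1.
have i12 i : i = i1 \/ i = i2.
  have := ltn_ord i; rewrite {2}dimH.
  by case: i => -[|[|//]] ? _; [left | right]; exact: val_inj.
pose e1 := tnth e i1; pose e2 := tnth e i2.
have [eH eo] := eb.
have e1H : e1 \in H by exact/(basis_mem eH)/mem_tnth.
have e2H : e2 \in H by exact/(basis_mem eH)/mem_tnth.
have e11 : dot e1 e1 = 1 by rewrite eo eqxx.
have e22 : dot e2 e2 = 1 by rewrite eo eqxx.
have e12 : dot e1 e2 = 0 by rewrite eo.
have e21 : dot e2 e1 = 0 by rewrite eo.
have expand x : x \in H -> x = dot x e1 *: e1 + dot x e2 *: e2.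
  move=> xH; rewrite {1}(orthonormal_expand eb xH) (bigD1 i1)//= (bigD1 i2)//=.
  by rewrite big1 ?addr0// => i; case: (i12 i) => ->; rewrite eqxx ?andbF.
have parseval x y : x \in H ->
    dot x y = dot x e1 * dot y e1 + dot x e2 * dot y e2.
  by move=> /expand {1}->; rewrite dotDl !dotZl !(dotC _ y).
(* The linear quarter turn of [H], sending [e1] to [e2] and [e2] to [- e1]. *)
pose J x := dot x e1 *: e2 - dot x e2 *: e1.
have JH x : J x \in H by rewrite memvB ?memvZ.
have J1 x : dot (J x) e1 = - dot x e2.
  by rewrite dotBl !dotZl e21 e11; ring.
have J2 x : dot (J x) e2 = dot x e1.
  by rewrite dotBl !dotZl e22 e12; ring.
have JN x : J (- x) = - J x by rewrite /J !dotNl !scaleNr opprB addrC opprK.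
have JB x y : J (x - y) = J x - J y.
  by apply/rowP => i; rewrite /J !dotBl !mxE; ring.
have JJ x : x \in H -> J (J x) = - x.
  by move=> /expand {2}->; rewrite {1}/J J1 J2 scaleNr opprD addrC.
have dotJ x y : x \in H -> dot (J x) (J y) = dot x y.
  by move=> xH; rewrite parseval// !J1 !J2 (parseval x y xH); ring.
(* The quarter turn about the centre of the square and, since [J] squares to [-1] on [H], its
   inverse there. *)
pose T x := c + J (x - c).
pose T' x := c - J (x - c).
have TH x : T x \in H by rewrite memvD.
have T'H x : T' x \in H by rewrite memvB.
have Tc x : T x - c = J (x - c) by rewrite /T addrC addKr.
have T'c x : T' x - c = - J (x - c) by rewrite /T' addrC addKr.
have TT' x : x \in H -> T (T' x) = x.
  by move=> xH; rewrite /T T'c JN JJ ?memvB// opprK addrC subrK.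
have suppJ w : w \in H -> supp K (J w) = supp K w + (dot c (J w) - dot c w).
  move=> wH; apply: (@supp_symmetry _ _ _ H T) => //; [|apply: QK; split|..].
  - by move=> x; exact: orthoproj_exists eb.
  - split.
      by apply: (image_eq_of_section (T' := T')) => x /= xH;
        rewrite ?TH ?T'H ?TT'.
    move=> x y xH yH; have -> : T x - T y = J (x - y).
      by rewrite /T opprD addrACA subrr add0r -JB opprB addrA subrK.
    by rewrite /enorm dotJ// memvB.
  - have abs12 x : (forall i, `|dot x (tnth e i)| <= r) <->
        `|dot x e1| <= r /\ `|dot x e2| <= r.
      split=> [xr|[xr1 xr2] i]; first by split; exact: xr.
      by case: (i12 i) => ->.
    rewrite cubeE//.
    apply: (image_eq_of_section (T' := T')) => [x|x|x [+ _]] /=.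
    + by move=> [xH /abs12[]]; split=> //; apply/abs12; rewrite Tc J1 J2 normrN.
    + move=> [xH /abs12[]]; split=> //; apply/abs12.
      by rewrite T'c !dotNl J1 J2 !normrN.
    + exact: TT'.
  - by move=> x xH; rewrite /T dotDl dotJ ?memvB// dotBl; ring.
(* The correction due to the centre is odd in [w], so it cancels in the width. *)
have widthJ w : w \in H ->
    supp K (J w) + supp K (- J w) = supp K w + supp K (- w).
  move=> wH; rewrite -JN !suppJ ?memvN// JN !dotNr; ring.
have Ju1 : dot (J u) (J u) = 1 by rewrite dotJ.
pose s := dot v (J u).
have vJu : v = s *: J u.
  have sE : s = dot v e2 * dot u e1 - dot v e1 * dot u e2.
    by rewrite /s parseval// J1 J2; ring.
  have -> : s *: J u = (- s * dot u e2) *: e1 + (s * dot u e1) *: e2.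
    by rewrite /J scalerBr !scalerA mulNr scaleNr addrC.
  rewrite [LHS](expand v vH) sE.
  (* Each coordinate of [v] comes from multiplying the unit length equation of [u] by it and
     subtracting a multiple of the orthogonality equation. *)
  move: uv u1; rewrite (parseval u v uH) (parseval u u uH).
  set a := dot u e1; set b := dot u e2.
  set a' := dot v e1; set b' := dot v e2 => uv u1; congr (_ *: _ + _ *: _).
    have : a * (a * a' + b * b') = 0 by rewrite uv mulr0.
    have : a' * (a * a + b * b) = a' by rewrite u1 mulr1.
    lra.
  have : b * (a * a' + b * b') = 0 by rewrite uv mulr0.
  have : b' * (a * a + b * b) = b' by rewrite u1 mulr1.
  lra.
have : s * s = 1 by rewrite -v1 vJu dotZl dotZr Ju1 mulr1.
move/eqP; rewrite -expr2 sqrf_eq1 -widthJ// => /orP[] /eqP s1.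
  by rewrite vJu s1 scale1r.
by rewrite vJu s1 scaleN1r opprK addrC.
Qed.

End Cube.

(** * From linearity on planes to linearity *)

Section PlaneWise.
Context {R : realType} {n : nat}.
Implicit Types (u v : 'rV[R]_n) (g : 'rV[R]_n -> R).

(** The representing vector may vary with [H], but a linearity identity involves only two vectors,
    and these span a subspace of dimension at most 2. The global vector is then read off on the
    standard basis. *)
Lemma planewise_linear g :
  (forall H : {vspace 'rV[R]_n}, (\dim H <= 2)%N ->
     exists c, forall u, u \in H -> g u = dot c u) ->
  exists c, forall u, g u = dot c u.
Proof.
move=> planar.
have glin a u v : g (a *: u + v) = a * g u + g v.
  have [c gc] := planar <<[:: u; v]>>%VS (dim_span _).
  have uH : u \in <<[:: u; v]>>%VS by rewrite memv_span ?mem_head.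
  have vH : v \in <<[:: u; v]>>%VS by rewrite memv_span ?inE ?eqxx ?orbT.
  by rewrite !gc ?memvD ?memvZ// dotDr dotZr.
have g0 : g 0 = 0 by have := glin 1 0 0; rewrite scaler0 addr0; lra.
have gD u v : g (u + v) = g u + g v by rewrite -(scale1r u) glin mul1r scale1r.
have gZ a u : g (a *: u) = a * g u by rewrite -[a *: u]addr0 glin g0 addr0.
exists (\row_i g (delta_mx 0 i)) => u.
rewrite {1}(row_sum_delta u) (big_morph g gD g0).
by apply: eq_bigr => i _; rewrite gZ mxE mulrC.
Qed.

End PlaneWise.

(** * Recovering a ball from its support function *)

Section Ball.
Context {R : realType} {n : nat}.
Implicit Types (u v x y c : 'rV[R]_n) (K : set 'rV[R]_n).

(** A point of [K] is tested in the direction [x - c]; for a point of the ball outside [K], a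
    separating direction would contradict Cauchy-Schwarz. *)
Lemma supp_ball K c r : compact K -> K !=set0 ->
  convex_set (K : set (convex_lmodType 'rV[R]_n)) -> 0 <= r ->
  (forall u, dot u u = 1 -> supp K u = dot c u + r) ->
  K = [set x | enorm (x - c) <= r].
Proof.
move=> cK K0 convK r0 suppE; apply/seteqP; split => x /=.
  move=> Kx; have [->|/unit_scale[u u1 xcu]] := eqVneq (x - c) 0.
    by rewrite /enorm dot0l sqrtr0.
  have := le_supp u cK Kx; rewrite suppE// -lerBlDl -dotBl {1}xcu dotZl u1.
  by rewrite mulr1.
move=> xr; apply: contrapT => /(supp_separation cK K0 convK)[u u1].
rewrite suppE// -ltrBrDl -dotBl ltNge => /negP; apply.
exact: le_trans (dot_le_enorm _ u1) xr.
Qed.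

Lemma interior_has_line K x u : interior K x ->
  exists2 t, 0 < t & K (x + t *: u).
Proof.
move=> /nbhs_ballP[e /= e0 eK].
(* The neighbourhood is a ball of the sup norm; adding 1 avoids division by zero when [u = 0]. *)
exists (e / 2 / (`|u| + 1)); first by rewrite !divr_gt0// ltr_wpDl.
apply: eK; rewrite -ball_normE /= opprD addrA subrr add0r normrN normrZ.
rewrite ger0_norm ?divr_ge0 ?ltW// ?ltr_wpDl//.
have u1 : 0 < `|u| + 1 by rewrite ltr_wpDl.
rewrite mulrAC ltr_pdivrMr// mulrDr mulr1.
have : 0 <= e * `|u| by rewrite mulr_ge0// ltW.
lra.
Qed.

End Ball.

Unset Implicit Arguments.

Theorem corollary1p8 (R : realType) (n : nat) (hn : (3 <= n)%N)
  (K : set 'rV[R]_n) (hK : convex_body K)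
  (hproj : forall H : {vspace 'rV[R]_n}, (1 <= \dim H <= n - 1)%N ->
     one_symmetric H (projection H K)) :
  euclidean_ball K.
Proof.
have [cK convK [x0 x0K]] := hK.
have Kx0 : K x0 by exact: interior_subset.
have K0 : K !=set0 by exists x0.
have dim_le2 d : (d <= 2)%N -> (d <= n - 1)%N.
  by move=> /leq_trans; apply; rewrite leq_subRL ?(leq_trans _ hn).
have [c2 c2E] : exists c, forall u, supp K u - supp K (- u) = dot c u.
  apply: planewise_linear => H dimH.
  (* [hproj] says nothing about the zero subspace, where the claim is trivial. *)
  have [dim0|dim_gt0] := posnP (\dim H).
    exists 0 => u; move/eqP: dim0; rewrite dimv_eq0 => /eqP->.
    by rewrite memv0 => /eqP->; rewrite oppr0 subrr dot0l.
  have [|c cE] := supp_opp_one_symmetric cK K0 (hproj H _).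
    by rewrite dim_gt0 dim_le2.
  by exists (2 *: c) => u uH; rewrite cE// dotZl; ring.
have width_orth u v : dot u u = 1 -> dot v v = 1 -> dot u v = 0 ->
    supp K u + supp K (- u) = supp K v + supp K (- v).
  move=> u1 v1 uv; pose H := <<[:: u; v]>>%VS.
  have dimH : \dim H = 2%N.
    suff /eqP : free [:: u; v] by [].
    rewrite free_cons seq1_free -dot_eq0 v1 oner_neq0 andbT span_seq1.
    apply/negP => /vlineP[a ua]; move: uv; rewrite ua dotZl v1 mulr1 => a0.
    by move/eqP: u1; rewrite ua a0 scale0r dot0l eq_sym oner_eq0.
  apply: (@width_one_symmetric _ _ K H) => //.
  - by apply: hproj; rewrite dimH dim_le2.
  - by rewrite memv_span ?mem_head.
  - by rewrite memv_span ?inE ?eqxx ?orbT.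
have width u v : dot u u = 1 -> dot v v = 1 ->
    supp K u + supp K (- u) = supp K v + supp K (- v).
  move=> u1 v1; have [w [w1 wu wv]] := orthogonal_unit u v hn.
  by rewrite -(width_orth w u)// -(width_orth w v).
have [w [w1 _ _]] := orthogonal_unit (0 : 'rV[R]_n) 0 hn.
(* Two points of [K] that differ by [t *: w] force the width in direction [w] to be at least [t], so
   the radius is positive. *)
have [t t0 Kt] := interior_has_line w x0K.
have width_gt0 : 0 < supp K w + supp K (- w).
  have := le_supp w cK Kt; have := le_supp (- w) cK Kx0.
  by rewrite dotDl dotZl w1 dotNr; lra.
(* The value [supp K u] is half the sum of the linear difference [supp K u - supp K (- u)] and the
   constant width; these halves give the centre and the radius. *)
exists (2^-1 *: c2), (2^-1 * (supp K w + supp K (- w))).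
  by rewrite mulr_gt0.
apply: supp_ball => //; first by rewrite mulr_ge0 ?ltW.
by move=> u u1; rewrite dotZl -c2E (width w u)//; lra.
Qed.
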